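(* Let $N\ge 2$, let $\mathrm{g}$ be a coupling function, and consider effective coupling graphs of the all-to-all coupled network $\dot\theta_k=\omega+\sum_{j\ne k}\mathrm{g}(\theta_j-\theta_k)$, $k=1,\dots,N$, on $\mathbb{T}^N$. Let $\theta\in\mathbb{T}^N$ be fixed. (i) If $\theta$ has isotropy $\Sigma_\theta$, then $\mathcal{G}_{\mathrm{g}}(\theta)$ has at least the same isotropy, i.e. $\Sigma_\theta\subset\Sigma_{\mathcal{G}_{\mathrm{g}}(\theta)}$. (ii) For full synchrony $\Theta^{\mathrm{sync}}=(\phi,\dots,\phi)$ with $\phi\in\mathbb{T}$, we have $\mathcal{G}_{\mathrm{g}}(\Theta^{\mathrm{sync}})\in\{\boldsymbol{\emptyset}_N,\mathbf{K}_N\}$. (iii) Suppose there exists $0<a<2\pi/N$ such that $\theta_{k+1}-\theta_k=a$ (modulo $2\pi$) for every $k\in\{1,\dots,N-1\}$. Then (at least) one of the following cases occurs: (1) the directed path $\mathbf{P}_{N,N-1,\dots,1}$ is a subgraph of $\mathcal{G}_{\mathrm{g}}(\theta)$ but $\mathbf{P}_{1,2,\dots,N}$ is not; (2) the directed path $\mathbf{P}_{1,2,\dots,N}$ is a subgraph of $\mathcal{G}_{\mathrm{g}}(\theta)$ but $\mathbf{P}_{N,N-1,\dots,1}$ is not; (3) the undirected path $\bar{\mathbf{P}}_{1,2,\dots,N}$ is a subgraph of $\mathcal{G}_{\mathrm{g}}(\theta)$; (4) $\mathcal{G}_{\mathrm{g}}(\theta)$ is an $n$-partite graph, with $n=N/2$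 if $N$ is even and $n=\lfloor N/2\rfloor+1$ if $N$ is odd.
   Context: $\mathbb{T}=\mathbb{R}/2\pi\mathbb{Z}$. A coupling function is a non-constant smooth function $\mathrm{g}:\mathbb{T}\to\mathbb{R}$. Let $\mathrm{LC}(\mathrm{g})$ be the set of points of $\mathbb{T}$ having an open neighbourhood on which $\mathrm{g}$ is constant, and $\mathrm{DZ}(\mathrm{g})$ the set of points having an open neighbourhood on which $\mathrm{g}\equiv 0$. All coupling functions are assumed to have simple dead zones: $\mathrm{DZ}(\mathrm{g})$ has finitely many connected components and $\mathrm{LC}(\mathrm{g})=\mathrm{DZ}(\mathrm{g})$. The effective coupling graph $\mathcal{G}_{\mathrm{g}}(\theta)$ at $\theta\in\mathbb{T}^N$ is the directed graph on $\{1,\dots,N\}$ with edge set $\{(j,k): j\neq k,\ \theta_j-\theta_k\notin\mathrm{DZ}(\mathrm{g})\}$, where $(j,k)$ is an edge from $j$ to $k$. Graphs on $\{1,\dots,N\}$: $\mathbf{K}_N$ has all edges $(j,k)$, $j\ne k$; $\boldsymbol{\emptyset}_N$ has no edges; $\mathbf{P}_{p_1,\dots,p_r}$ has edges $(p_q,p_{q+1})$, $q=1,\dots,r-1$; $\bar{\mathbf{P}}_{p_1,\dots,p_r}$ is $\mathbf{P}_{p_1,\dots,p_r}$ with all reverse edges added. A directed graph is $n$-partite if its vertex set can be partitioned into $n$ independent sets (sets no two of whose nodes are joined by an edge in either direction). The symmetric group $\mathbb{S}_N$ acts on $\mathbb{T}^N$ by permuting components, and on directed graphs on $\{1,\dots,N\}$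 by $E(\gamma\mathbf{H})=\{(\gamma(j),\gamma(k)):(j,k)\in E(\mathbf{H})\}$. The isotropy groups are $\Sigma_\theta=\{\gamma\in\mathbb{S}_N:\gamma\theta=\theta\}$ and $\Sigma_{\mathbf{H}}=\{\gamma\in\mathbb{S}_N:\gamma\mathbf{H}=\mathbf{H}\}$. *)

(* Defs.v *)
From HB Require Import structures.
From mathcomp Require Import all_boot all_order all_algebra all_fingroup.
From mathcomp Require Import all_classical all_reals all_analysis.

Set Implicit Arguments.
Unset Strict Implicit.
Unset Printing Implicit Defensive.

Import Order.TTheory GRing.Theory Num.Theory.
Import numFieldNormedType.Exports.

Local Open Scope classical_set_scope.
Local Open Scope ring_scope.
Local Open Scope quotient_scope.

Definition twopiZ (R : realType) : {pred R} :=
  fun x => x / (2 * pi) \is a Num.int.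

Lemma twopiZ_zmod_closed (R : realType) : zmod_closed (@twopiZ R).
Proof.
have twopiZE (x : R) : (x \in @twopiZ R) = (x / (2 * pi) \is a Num.int) by [].
split=> [|x y]; first by rewrite twopiZE mul0r rpred0.
by rewrite !twopiZE mulrBl => xZ yZ; rewrite rpredB.
Qed.

HB.instance Definition _ (R : realType) :=
  GRing.isZmodClosed.Build R (@twopiZ R) (@twopiZ_zmod_closed R).

(* R / 2 pi Z, with the quotient topology and the quotient additive group. *)
Definition circle (R : realType) : Type :=
  quotient_topology (Quotient.quot (@twopiZ R)).

HB.instance Definition _ (R : realType) :=
  Topological.copy (circle R)
    (quotient_topology (Quotient.quot (@twopiZ R))).
HB.instance Definition _ (R : realType) :=
  GRing.Zmodule.copy (circle R) (Quotient.quot (@twopiZ R)).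

Definition to_circle (R : realType) (x : R) : circle R :=
  \pi_(Quotient.quot (@twopiZ R)) x.

Section CouplingFunctions.
Variable R : realType.
Implicit Type g : circle R -> R.

(* C^oo on the circle, read on the 2 pi-periodic lift to the line. *)
Definition smooth g : Prop :=
  forall (n : nat) (x : R), derivable (g \o @to_circle R)^`(n)%classic x 1.

Definition locally_constant_set g : set (circle R) :=
  [set x | exists2 U : set (circle R), open_nbhs x U &
             exists c : R, forall y, U y -> g y = c].

Definition dead_zone g : set (circle R) :=
  [set x | exists2 U : set (circle R), open_nbhs x U &
             forall y, U y -> g y = 0].

Definition simple_dead_zones g : Prop :=
  finite_set (connected_component (dead_zone g) @` dead_zone g) /\
  locally_constant_set g = dead_zone g.

Definition coupling_function g : Prop :=
  [/\ smooth g,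
      ~ (exists c : R, forall x, g x = c)
    & simple_dead_zones g].

End CouplingFunctions.

(* Directed graphs on N nodes are given by their edge sets; (j, k) is the edge
   from j to k. The nodes 1, ..., N are 0, ..., N-1 here. *)
Definition digraph (N : nat) := {set 'I_N * 'I_N}.

Section Digraphs.
Variable N : nat.
Implicit Type (G : digraph N) (p : seq 'I_N).

Definition complete_graph : digraph N := [set e | e.1 != e.2]%SET.

Definition empty_graph : digraph N := finset.set0.

Definition path_graph p : digraph N := [set e in zip p (behead p)]%SET.

Definition undirected_path_graph p : digraph N :=
  (path_graph p :|: [set (e.2, e.1) | e in path_graph p])%SET.

Definition independent G (B : {set 'I_N}) : bool :=
  [forall j in B, forall k in B, (j, k) \notin G].

Definition n_partite (n : nat) G : Prop :=
  exists P : {set {set 'I_N}},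
    [/\ finset.partition P [set: 'I_N]%SET, #|P| = n
      & forall B, B \in P -> independent G B].

Definition act_graph (s : 'S_N) G : digraph N :=
  [set (s e.1, s e.2) | e in G]%SET.

Definition isotropy_graph G : {set 'S_N} :=
  [set s | act_graph s G == G]%SET.

End Digraphs.

Section States.
Variables (R : realType) (N : nat).
Implicit Type theta : {ffun 'I_N -> circle R}.

Definition act_state (s : 'S_N) theta : {ffun 'I_N -> circle R} :=
  [ffun k => theta ((s^-1)%g k)].

Definition isotropy_state theta : {set 'S_N} :=
  [set s | act_state s theta == theta]%SET.

Definition effective_graph (g : circle R -> R) theta : digraph N :=
  [set e | (e.1 != e.2) &&
           `[< ~ dead_zone g (theta e.1 - theta e.2) >]]%SET.

End States.

(* Main.v *)
Require Import Defs.
From HB Require Import structures.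
From mathcomp Require Import all_boot all_order all_algebra all_fingroup.
From mathcomp Require Import all_classical all_reals all_analysis.
From mathcomp Require Import zify.

Set Implicit Arguments.
Unset Strict Implicit.
Unset Printing Implicit Defensive.

Import Order.TTheory GRing.Theory Num.Theory.
Import numFieldNormedType.Exports.

Local Open Scope ring_scope.

(** All three claims rest on one remark: whether [(j, k)] is an edge of the
    effective coupling graph depends only on [j != k] and on the phase
    difference [theta j - theta k].

    A permutation fixing [theta] preserves all phase differences, hence maps
    edges to edges, and being injective it maps the edge set onto itself.
    At full synchrony every phase difference is [0], so either all the edges
    or none are present.

    On a splay-like state with constant increment [a], every step [(k+1, k)]
    has phase difference [a] and every step [(k, k+1)] has difference [- a].
    The four cases are then the four ways in which [a] and [- a] can lie inside
    or outside the dead zone.  When both lie inside it, no two consecutive nodes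
    are joined, and grouping the nodes in consecutive pairs, the last one alone
    if [N] is odd, gives the required partition into independent sets. *)

Section PathGraphs.
Variable N : nat.
Implicit Types (p : seq 'I_N) (i j : 'I_N).

(** Reading the edges of a path as its contiguous subsequences of length two
    makes reversal of the path transparent. *)
Lemma in_path_graph p i j : ((i, j) \in path_graph p) = infix [:: i; j] p.
Proof.
rewrite inE; elim: p => [|x [|y p] IHp] //=; first by rewrite andbF.
by rewrite in_cons IHp /= xpair_eqE prefix0s andbT.
Qed.

Lemma in_path_graph_rev p i j :
  ((i, j) \in path_graph (rev p)) = ((j, i) \in path_graph p).
Proof. by rewrite !in_path_graph -infix_rev revK. Qed.

Lemma in_path_graph_enum i j :
  ((i, j) \in path_graph (enum 'I_N)) = (j == i.+1 :> nat).
Proof.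
rewrite inE; set s := zip _ _.
have sz_s : size s = N.-1.
  by rewrite size_zip size_behead size_enum_ord; apply/minn_idPr/leq_pred.
have nth_s k : (k < N.-1)%N ->
    nth (i, j) s k = (nth i (enum 'I_N) k, nth j (enum 'I_N) k.+1).
  move=> kN; rewrite nth_zip_cond sz_s kN nth_behead //.
apply/(nthP (i, j))/eqP => [[k] | ji].
  rewrite sz_s => kN; rewrite nth_s // => -[<- <-].
  by rewrite !nth_enum_ord //; lia.
have jN := ltn_ord j.
exists (i : nat); first by rewrite sz_s; lia.
rewrite nth_s; last by lia.
by rewrite -ji !nth_ord_enum.
Qed.

(** The colour classes of a surjective proper colouring are non-empty, so they
    form a partition with as many blocks as colours. *)
Lemma n_partite_of_coloring n (G : digraph N) (f : 'I_N -> 'I_n) :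
    (forall c, exists i, f i = c) ->
    (forall i j, (i, j) \in G -> f i != f j) ->
  n_partite n G.
Proof.
move=> f_surj f_proper.
pose cls c := [set i | f i == c]%SET.
exists [set cls c | c in 'I_n]%SET; split.
- apply/and3P; split.
  + rewrite finset.eqEsubset finset.subsetT; apply/fintype.subsetP => i _.
    by apply/bigcupP; exists (cls (f i)); rewrite ?inE ?imset_f.
  + apply/finset.trivIsetP => _ _ /imsetP[c _ ->] /imsetP[d _ ->] cd.
    rewrite -finset.setI_eq0; apply/eqP/setP => i; rewrite !inE.
    by apply: contraNF cd => /andP[/eqP <- /eqP <-].
  + apply/imsetP => -[c _ /setP cls0]; have [i fi] := f_surj c.
    by have := cls0 i; rewrite !inE fi eqxx.
- rewrite card_imset ?card_ord // => c d /setP cd.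
  have [i fi] := f_surj c.
  by have := cd i; rewrite !inE fi eqxx => /esym/eqP.
- move=> _ /imsetP[c _ ->].
  apply/forall_inP => i; rewrite inE => /eqP fi.
  apply/forall_inP => j; rewrite inE => /eqP fj.
  by apply/negP => /f_proper; rewrite fi fj eqxx.
Qed.

Lemma undirected_path_graphE p :
  undirected_path_graph p = (path_graph p :|: path_graph (rev p))%SET.
Proof.
congr (_ :|: _)%SET; apply/setP => -[i j]; rewrite in_path_graph_rev.
apply/imsetP/idP => [[[k l] kl [-> ->]] // | ji].
by exists (j, i).
Qed.

Lemma path_graph_enum_sub (G : digraph N) (b : bool) :
    (2 <= N)%N -> (forall i j, j = i.+1 :> nat -> ((i, j) \in G) = b) ->
  (path_graph (enum 'I_N) \subset G) = b.
Proof.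
move=> hN Gb; apply/fintype.subsetP/idP => [sub | bT [i j]].
  pose i0 := Ordinal (ltnW hN); pose i1 := Ordinal hN.
  by rewrite -(Gb i0 i1) //; apply: sub; rewrite in_path_graph_enum.
by rewrite in_path_graph_enum => /eqP ji; rewrite Gb.
Qed.

Lemma path_graph_rev_enum_sub (G : digraph N) (b : bool) :
    (2 <= N)%N -> (forall i j, j = i.+1 :> nat -> ((j, i) \in G) = b) ->
  (path_graph (rev (enum 'I_N)) \subset G) = b.
Proof.
move=> hN Gb; apply/fintype.subsetP/idP => [sub | bT [j i]].
  pose i0 := Ordinal (ltnW hN); pose i1 := Ordinal hN.
  rewrite -(Gb i0 i1) //; apply: sub.
  by rewrite in_path_graph_rev in_path_graph_enum.
by rewrite in_path_graph_rev in_path_graph_enum => /eqP ji; rewrite Gb.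
Qed.

(** Colour node [i] by [i./2]: two distinct nodes of the same colour are
    consecutive, hence not joined. *)
Lemma n_partite_uphalf (G : digraph N) :
    (forall i, (i, i) \notin G) ->
    (forall i j, j = i.+1 :> nat -> (i, j) \notin G /\ (j, i) \notin G) ->
  n_partite (uphalf N) G.
Proof.
move=> G_irr G_step.
have half_lt (i : 'I_N) : (i./2 < uphalf N)%N by have := ltn_ord i; lia.
have dbl_lt (c : 'I_(uphalf N)) : (c.*2 < N)%N by have := ltn_ord c; lia.
apply: (n_partite_of_coloring (f := fun i => Ordinal (half_lt i))) => [c|i j].
  by exists (Ordinal (dbl_lt c)); apply: val_inj; rewrite /= doubleK.
apply: contraTN => /eqP[ij].
have [eq_ij | [/G_step[] // | /G_step[] //]] :
    nat_of_ord i = j \/ (nat_of_ord j = i.+1 \/ nat_of_ord i = j.+1) by lia.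
by rewrite (val_inj eq_ij).
Qed.

End PathGraphs.

Section EffectiveGraph.
Variables (R : realType) (N : nat) (g : circle R -> R).
Implicit Type theta : {ffun 'I_N -> circle R}.

Lemma in_effective_graph theta i j :
  ((i, j) \in effective_graph g theta) =
    (i != j) && ~~ `[< dead_zone g (theta i - theta j) >].
Proof. by rewrite inE asbool_neg. Qed.

Lemma isotropy_effective_graph theta :
  isotropy_state theta \subset isotropy_graph (effective_graph g theta).
Proof.
apply/fintype.subsetP => s; rewrite !inE => /eqP/ffunP s_theta.
have theta_s k : theta (s k) = theta k by rewrite -[LHS]s_theta ffunE permK.
have pair_inj : injective (fun e : 'I_N * 'I_N => (s e.1, s e.2)).
  by move=> [i j] [k l] /= [/perm_inj-> /perm_inj->].
(* An injective self-map sending a finite set into itself maps it onto itself. *)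
rewrite eqEcard card_imset // leqnn andbT.
apply/fintype.subsetP => _ /imsetP[[i j] ij ->] /=.
by move: ij; rewrite !in_effective_graph !theta_s (inj_eq perm_inj).
Qed.

Lemma effective_graph_sync (phi : circle R) :
  effective_graph g [ffun _ : 'I_N => phi] = empty_graph N \/
  effective_graph g [ffun _ : 'I_N => phi] = complete_graph N.
Proof.
have [dz0 | ndz0] := boolP `[< dead_zone g 0 >]; [left | right];
  apply/setP => -[i j]; rewrite in_effective_graph !ffunE subrr.
  by rewrite dz0 andbF inE.
by rewrite ndz0 andbT inE.
Qed.

Lemma effective_graph_splay theta (a : circle R) : (2 <= N)%N ->
    (forall j k : 'I_N, k = j.+1 :> nat -> theta k - theta j = a) ->
  let G := effective_graph g theta in
  let P_1N := path_graph (enum 'I_N) in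
  let P_N1 := path_graph (rev (enum 'I_N)) in
  [\/ (P_N1 \subset G) /\ ~~ (P_1N \subset G),
      (P_1N \subset G) /\ ~~ (P_N1 \subset G),
      undirected_path_graph (enum 'I_N) \subset G
    | n_partite (uphalf N) G].
Proof.
move=> hN step G P_1N P_N1.
have neq_step (i j : 'I_N) : j = i.+1 :> nat -> i != j.
  by move=> ji; rewrite -val_eqE /= ji; lia.
have G_up (i j : 'I_N) : j = i.+1 :> nat ->
    ((i, j) \in G) = ~~ `[< dead_zone g (- a) >].
  by move=> ji; rewrite in_effective_graph neq_step //= -opprB (step i).
have G_down (i j : 'I_N) : j = i.+1 :> nat ->
    ((j, i) \in G) = ~~ `[< dead_zone g a >].
  by move=> ji; rewrite in_effective_graph eq_sym neq_step //= (step i).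
rewrite undirected_path_graphE finset.subUset.
rewrite (path_graph_enum_sub hN G_up) (path_graph_rev_enum_sub hN G_down).
have [dza | ndza] := boolP `[< dead_zone g a >];
  have [dzNa | ndzNa] := boolP `[< dead_zone g (- a) >].
- apply: Or44; apply: n_partite_uphalf => [i | i j ji].
    by rewrite in_effective_graph eqxx.
  by rewrite G_up // G_down // dza dzNa.
- exact: Or42.
- exact: Or41.
- exact: Or43.
Qed.

End EffectiveGraph.

Theorem proposition2 (R : realType) (N : nat) (g : circle R -> R)
    (theta : {ffun 'I_N -> circle R})
    (hN : (2 <= N)%N) (hg : coupling_function g) :
  [/\ isotropy_state theta \subset isotropy_graph (effective_graph g theta),
      forall phi : circle R,
        effective_graph g [ffun _ : 'I_N => phi] = empty_graph N \/
        effective_graph g [ffun _ : 'I_N => phi] = complete_graph N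
    & (exists2 a : R, 0 < a < 2 * pi / N%:R &
         forall j k : 'I_N, k = j.+1 :> nat ->
           theta k - theta j = to_circle a) ->
      let G := effective_graph g theta in
      let P_1N := path_graph (enum 'I_N) in
      let P_N1 := path_graph (rev (enum 'I_N)) in
      [\/ (P_N1 \subset G) /\ ~~ (P_1N \subset G),
          (P_1N \subset G) /\ ~~ (P_N1 \subset G),
          undirected_path_graph (enum 'I_N) \subset G
        | n_partite (if odd N then (N %/ 2).+1 else N %/ 2)%N G]].
Proof.
split; [exact: isotropy_effective_graph | exact: effective_graph_sync |].
move=> [a _ step].
have -> : (if odd N then (N %/ 2).+1 else N %/ 2)%N = uphalf N.
  by rewrite divn2 uphalf_half; case: odd.
exact: effective_graph_splay step.
Qed.
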